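(* Let $\alpha$ be an algebraic number of degree $8$ over $\mathbb{Q}$ and let $p(x)$ be its minimal polynomial over $\mathbb{Q}$. Some four distinct algebraic conjugates $\alpha_1,\alpha_2,\alpha_3,\alpha_4$ of $\alpha$ satisfy the relation $$\alpha_{1}+\alpha_{2}+\alpha_{3}+\alpha_{4}=0$$ if and only if $p(x)$ is an irreducible polynomial which, for some $a,b,c,d,e,f\in\mathbb{Q}$ and some square-free integer $t$, is equal to one of the polynomials $p_1(x),p_2(x),p_3(x),p_4(x)$, where \begin{align*} p_1(x)=\;&x^{8} + 2ax^{6} + 2cx^{5} + (a^{2} - b^{2}t + 2e) x^{4} + 2(ac - bdt)x^{3}\\ &+ (2(ae - bft) + c^{2} - d^{2}t)x^{2} + 2(ce - dft)x + (e^{2}-f^{2}t),\\ p_2(x)=\;&x^{8}-2(a^{2}t-b)x^{6}+2actx^{5}+( a^{4}t^2 -2a^{2}bt+b^{2}-c^{2}t+2d)x^{4}\\ &-2at(a^{2}ct-2e)x^{3}+( a^2c^2t^2-a^2b^2t+2a^2dt-2cet+2bd)x^{2}\\ &+2at(be-cd)x+d^{2}-e^{2}t,\\ p_3(x)=\;&x^{8} + (-4 a + 2 b) x^{6} + 2 c x^{5} + (6 a^{2} - 2 a b + b^{2} + 2 d) x^{4}\\ &+(4 a c + 2 b c) x^{3}+ (-4 a^{3} - 2 a^{2} b - 2 a b^{2} + 12 a d + c^{2} + 2 b d) x^{2}\\ &-2c(3a^{2} + a b - d) x+ a^{4} + 2 a^{3} b + a^{2} b^{2} + 2 a^{2} d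 - a c^{2} + 2 a b d + d^{2},\\ p_4(x)=\;&x^{8}+ax^{6}+bx^{4}+cx^{2}+d. \end{align*}
   Context: The algebraic conjugates of $\alpha$ are the complex roots of its (monic) minimal polynomial over $\mathbb{Q}$. *)

(* Defs.v *)
From mathcomp Require Import all_boot all_order all_algebra all_field.

Set Implicit Arguments.
Unset Strict Implicit.
Unset Printing Implicit Defensive.

Import GRing.Theory Num.Theory.
Local Open Scope ring_scope.

(* 1 and -1 are square-free, 0 is not. *)
Definition squarefree_int (t : int) : Prop :=
  forall m : int, (m ^+ 2 %| t)%Z -> m \is a GRing.unit.

(* [algC] is the field of algebraic complex numbers, so it contains every
   complex root of [minCpoly alpha]. *)
Definition alg_conjugate (alpha beta : algC) : bool :=
  root (minCpoly alpha) beta.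

Definition p1 (a b c d e f t : rat) : {poly rat} :=
  'X^8 + (2 * a) *: 'X^6 + (2 * c) *: 'X^5
  + (a ^+ 2 - b ^+ 2 * t + 2 * e) *: 'X^4
  + (2 * (a * c - b * d * t)) *: 'X^3
  + (2 * (a * e - b * f * t) + c ^+ 2 - d ^+ 2 * t) *: 'X^2
  + (2 * (c * e - d * f * t)) *: 'X
  + (e ^+ 2 - f ^+ 2 * t)%:P.

Definition p2 (a b c d e t : rat) : {poly rat} :=
  'X^8 - (2 * (a ^+ 2 * t - b)) *: 'X^6 + (2 * a * c * t) *: 'X^5
  + (a ^+ 4 * t ^+ 2 - 2 * a ^+ 2 * b * t + b ^+ 2 - c ^+ 2 * t + 2 * d)
      *: 'X^4
  - (2 * a * t * (a ^+ 2 * c * t - 2 * e)) *: 'X^3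
  + (a ^+ 2 * c ^+ 2 * t ^+ 2 - a ^+ 2 * b ^+ 2 * t + 2 * a ^+ 2 * d * t
     - 2 * c * e * t + 2 * b * d) *: 'X^2
  + (2 * a * t * (b * e - c * d)) *: 'X
  + (d ^+ 2 - e ^+ 2 * t)%:P.

Definition p3 (a b c d : rat) : {poly rat} :=
  'X^8 + (- 4 * a + 2 * b) *: 'X^6 + (2 * c) *: 'X^5
  + (6 * a ^+ 2 - 2 * a * b + b ^+ 2 + 2 * d) *: 'X^4
  + (4 * a * c + 2 * b * c) *: 'X^3
  + (- 4 * a ^+ 3 - 2 * a ^+ 2 * b - 2 * a * b ^+ 2 + 12 * a * d + c ^+ 2
     + 2 * b * d) *: 'X^2
  - (2 * c * (3 * a ^+ 2 + a * b - d)) *: 'X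
  + (a ^+ 4 + 2 * a ^+ 3 * b + a ^+ 2 * b ^+ 2 + 2 * a ^+ 2 * d - a * c ^+ 2
     + 2 * a * b * d + d ^+ 2)%:P.

Definition p4 (a b c d : rat) : {poly rat} :=
  'X^8 + a *: 'X^6 + b *: 'X^4 + c *: 'X^2 + d%:P.

(* Main.v *)
(* Identify a zero-sum quadruple of roots and its complement (the trace vanishes
   as well) with a bipartition of the eight roots.  If no two roots are opposite
   (otherwise p is even, i.e. p4), any two such bipartitions cross 2-2-2-2: an
   intersection of size 3 would force two equal roots.  The Galois group
   permutes these bipartitions, and only three configurations survive.  A single
   bipartition is Galois-invariant, so p is the norm of a quartic over a
   quadratic field: p1.  With two, the four blocks have sums x, -x, -x, x with
   x^2 rational, and the two blocks of sum x form half of an invariant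
   bipartition: p2.  With three, the roots are y_i + w and y_i - w where w^2 is
   rational and the y_i are the roots of a rational quartic: p3. *)
Require Import Defs.
From HB Require Import structures.
From mathcomp Require Import all_boot all_order all_algebra all_field.
From mathcomp Require Import ring.

Set Implicit Arguments.
Unset Strict Implicit.
Unset Printing Implicit Defensive.

Import GRing.Theory Num.Theory.
Local Open Scope ring_scope.

(** * Minimal polynomials and their roots *)

(** One factor of [p] vanishes at [x], hence is a multiple of [p]. If it is the cofactor [r],
    comparing sizes makes [q] a constant. *)
Lemma minCpoly_irreducible (x : algC) (p : {poly rat}) :
  map_poly ratr p = minCpoly x -> irreducible_poly p.
Proof.
have [m [Dm _] m_dvd] := minCpolyP x; rewrite Dm => /map_poly_inj Dp.
have p_dvd q : root (map_poly ratr q) x = (p %| q) by rewrite m_dvd Dp.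
rewrite -Dp in Dm.
have p_neq0 : p != 0 by rewrite -(map_poly_eq0 (ratr : {rmorphism rat -> algC})) -Dm minCpoly_eq0.
split=> [|q q_size1 /dvdpP[r Dr]].
  by rewrite -(size_map_poly (ratr : {rmorphism rat -> algC})) -Dm size_minCpoly.
have := root_minCpoly x; rewrite Dm {1}Dr rmorphM rootM !p_dvd => /orP[]; last first.
  by move=> pq; rewrite /eqp pq andbT Dr dvdp_mull.
have r_neq0 : r != 0 by apply: contraNneq p_neq0 => r0; rewrite Dr r0 mul0r.
have q_neq0 : q != 0 by apply: contraNneq p_neq0 => q0; rewrite Dr q0 mulr0.
move/(dvdp_leq r_neq0); rewrite {1}Dr size_mul // -subn1 leq_subLR addnC leq_add2r.
by rewrite leq_eqVlt ltnS leqn0 size_poly_eq0 (negPf q_neq0) orbF (negPf q_size1).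
Qed.

Lemma minCpoly_conj (x y : algC) : root (minCpoly x) y -> minCpoly y = minCpoly x.
Proof.
have [p [Dp p_mon] p_dvd] := minCpolyP x; have [q [Dq q_mon] q_dvd] := minCpolyP y.
rewrite Dp Dq q_dvd => qp; congr (map_poly _ _); apply/eqP.
rewrite -eqp_monic //; apply: (minCpoly_irreducible (esym Dp)).2 => //.
by rewrite -(size_map_poly (ratr : {rmorphism rat -> algC})) -Dq neq_ltn size_minCpoly orbT.
Qed.

(** By irreducibility, a nonconstant common divisor of [p] and its derivative would be [p] up to a
    constant. But in characteristic zero the derivative is nonzero, its top coefficient being the
    degree of [p], and it has smaller size. *)
Lemma minCpoly_separable (x : algC) : separable_poly (minCpoly x).
Proof.
have [p [Dp p_mon] _] := minCpolyP x; rewrite Dp separable_map.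
have [p_gt1 p_irr] := minCpoly_irreducible (esym Dp).
rewrite unlock /coprimep; have [//|g_neq1] := eqVneq.
have /eqp_dvdl := p_irr _ g_neq1 (dvdp_gcdl _ _) => /(_ p^`()).
rewrite dvdp_gcdr => /esym/dvdp_leq dp_leq.
have dp_neq0 : p^`() != 0.
  apply/eqP => /(congr1 (fun q : {poly rat} => q`_(size p).-2))/eqP.
  have p_size : (size p).-2.+1 = (size p).-1 by case: (size p) p_gt1 => [|[]].
  rewrite coef_deriv coef0 p_size -lead_coefE (monicP p_mon) pnatr_eq0.
  by case: (size p) p_gt1 => [|[]].
by have := dp_leq dp_neq0; rewrite leqNgt lt_size_deriv // monic_neq0.
Qed.

Lemma minCpoly_roots (x : algC) : {rs : seq algC |
  minCpoly x = \prod_(r <- rs) ('X - r%:P) & uniq rs}.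
Proof.
have [rs Drs] := closed_field_poly_normal (minCpoly x).
rewrite (monicP (minCpoly_monic x)) scale1r in Drs.
by exists rs; rewrite // -separable_prod_XsubC -Drs minCpoly_separable.
Qed.

(** * Galois action on the conjugates *)

Lemma map_in_alg_algC (L : fieldExtType rat) (LC : {rmorphism L -> algC})
    (p : {poly rat}) : map_poly LC (map_poly (in_alg L) p) = map_poly ratr p.
Proof.
rewrite -map_poly_comp; apply: eq_map_poly => a.
by rewrite /= rmorphZ_num rmorph1 mulr1.
Qed.

(** Embedded in [algC], [minPoly 1 x] becomes a rational polynomial vanishing at [LC x], hence a
    multiple of [minCpoly (LC x)]. *)
Lemma root_minPoly_minCpoly (L : fieldExtType rat)
    (LC : {rmorphism L -> algC}) (x y : L) :
  root (minCpoly (LC x)) (LC y) -> root (minPoly 1 x) y.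
Proof.
have [p [Dp _] p_dvd] := minCpolyP (LC x).
have [q Dq] := polyOver1P (minPolyOver 1%AS x).
rewrite Dp -(map_in_alg_algC LC) fmorph_root Dq -!dvdp_XsubCl => /dvdp_trans-> //.
rewrite dvdp_map -p_dvd -(map_in_alg_algC LC) fmorph_root -Dq.
exact: root_minPoly.
Qed.

(** The number field generated by [rs] is a splitting field, because [rs] lists all the roots of a
    rational polynomial. Galois theory thus becomes available inside [algC]. *)
Lemma splitting_num_field (x : algC) (rs : seq algC) :
    minCpoly x = \prod_(r <- rs) ('X - r%:P) ->
  exists (L : splittingFieldType rat) (LC : {rmorphism L -> algC}),
    exists rs1 : seq L, map LC rs1 = rs.
Proof.
move=> Dx; have [L [LC [rs1 Drs1 genL]]] := num_field_exists rs.
have [p [Dp _] _] := minCpolyP x.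
have splitL : SplittingField.axiom L.
  exists (map_poly (in_alg L) p); first by apply/polyOver1P; exists p.
  exists rs1 => //; congr (_ %= _): (eqpxx (map_poly (in_alg L) p)).
  apply/(map_poly_inj LC); rewrite map_in_alg_algC -Dp Dx -Drs1.
  by rewrite big_map map_prod_XsubC.
pose Lsplit := FieldExt_isSplittingField.Build _ L splitL.
pose L' : splittingFieldType rat := HB.pack L Lsplit.
by exists L', LC, rs1.
Qed.

(** The index type is the Galois group of the splitting field, each element being extended to an
    automorphism of [algC]. Conjugates have equal traces because translating the group by [g] only
    reindexes the sum. *)
Lemma conj_automorphisms (x : algC) (rs : seq algC) :
    minCpoly x = \prod_(r <- rs) ('X - r%:P) ->
  exists (I : finType) (nu : I -> {rmorphism algC -> algC}),
    (0 < #|I|)%N /\ {in rs &, forall y z,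
      (exists i, nu i y = z) /\ \sum_i nu i y = \sum_i nu i z}.
Proof.
move=> Dx; have [L [LC [rs1 Drs1]]] := splitting_num_field Dx.
pose ext (g : gal_of {:L}) := extend_algC_subfield_aut LC (g : {rmorphism L -> L}).
exists (gal_of {:L}), (fun g => sval (ext g)).
have extE g y : sval (ext g) (LC y) = LC (g y) by case: (ext g) => nu /= ->.
split=> [|y z]; first by apply/card_gt0P; exists 1%g.
rewrite -Drs1 => /mapP[y1 y1s ->{y}] /mapP[z1 z1s ->{z}].
have rootLC u : u \in rs1 -> root (minCpoly x) (LC u).
  by move=> us; rewrite Dx root_prod_XsubC -Drs1 map_f.
have yz : root (minPoly 1 y1) z1.
  by apply: (root_minPoly_minCpoly (LC := LC)); rewrite (minCpoly_conj (rootLC y1 y1s)) rootLC.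
have [g _ Dg] := normalField_root_minPoly (sub1v _) (normalFieldf 1) (memvf y1) yz.
split; first by exists g; rewrite extE Dg.
rewrite -Dg [LHS](reindex_inj (mulgI g)); apply: eq_bigr => h _.
by rewrite !extE galM ?memvf.
Qed.

Lemma conj_aut (x y : algC) :
  root (minCpoly x) y -> exists nu : {rmorphism algC -> algC}, nu x = y.
Proof.
have [rs Dx _] := minCpoly_roots x; rewrite Dx root_prod_XsubC => y_rs.
have x_rs : x \in rs by rewrite -root_prod_XsubC -Dx root_minCpoly.
have [I [nu [_ nuP]]] := conj_automorphisms Dx.
by have [[i <-] _] := nuP x y x_rs y_rs; exists (nu i).
Qed.

(** Every conjugate of [x] equals [x], so by separability the minimal polynomial is X - x, and its
    constant coefficient is rational. *)
Lemma Crat_fixed (x : algC) :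
  (forall nu : {rmorphism algC -> algC}, nu x = x) -> x \in Crat.
Proof.
move=> nux; have [rs Dx rs_uniq] := minCpoly_roots x.
have rs_x y : y \in rs -> y = x.
  by rewrite -root_prod_XsubC -Dx => /conj_aut[nu <-].
have x_rs : x \in rs by rewrite -root_prod_XsubC -Dx root_minCpoly.
have{rs_uniq} Drs : rs = [:: x].
  case: rs rs_uniq rs_x x_rs {Dx} => [|y [|z rs]] //= rs_uniq rs_x _.
    by rewrite (rs_x y) ?mem_head.
  have yx : y = x by apply: rs_x; rewrite mem_head.
  have zx : z = x by apply: rs_x; rewrite in_cons mem_head orbT.
  by rewrite yx zx in_cons eqxx in rs_uniq.
have [p [Dp _] _] := minCpolyP x; apply/CratP; exists (- p`_0).
rewrite rmorphN -coef_map -Dp Dx Drs big_seq1 coefB coefX coefC.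
by rewrite sub0r opprK.
Qed.

(* The trace over the Galois group is constant on the conjugates, hence zero. *)
Lemma conj_sum_eq0 (x : algC) (rs s : seq algC) :
    minCpoly x = \prod_(r <- rs) ('X - r%:P) -> {subset s <= rs} ->
    (0 < size s)%N -> \sum_(y <- s) y = 0 -> \sum_(r <- rs) r = 0.
Proof.
move=> Dx s_rs s_gt0 s0; have [I [nu [I_gt0 nuP]]] := conj_automorphisms Dx.
have [p [Dp _] _] := minCpolyP x.
have x_rs : x \in rs by rewrite -root_prod_XsubC -Dx root_minCpoly.
have tr_const y : y \in rs -> \sum_i nu i y = \sum_i nu i x.
  by move=> y_rs; have [] := nuP y x y_rs x_rs.
have tr_sum s1 : {subset s1 <= rs} ->
    \sum_i nu i (\sum_(y <- s1) y) = (\sum_i nu i x) *+ size s1.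
  move=> s1_rs; under eq_bigr => i _ do rewrite rmorph_sum.
  rewrite exchange_big /= (eq_big_seq (fun=> \sum_i nu i x)) => [|y /s1_rs /tr_const//].
  by rewrite big_const_seq count_predT iter_addr_0.
have /esym/eqP := tr_sum s s_rs.
rewrite s0; under [X in _ == X]eq_bigr => i _ do rewrite rmorph0.
rewrite big1_eq.
rewrite mulrn_eq0 eqn0Ngt s_gt0 /= => /eqP tr0.
(* The sum of all the roots is minus a coefficient of [p], so it is rational and its trace is a
   positive multiple of itself. *)
have := tr_sum rs (fun y => id); rewrite tr0 mul0rn.
have rs_neq0 : size rs != 0%N by case: (rs) x_rs.
have := coefPn_prod_XsubC rs_neq0; rewrite -Dx Dp coef_map => /eqP.
rewrite eq_sym eqr_oppLR => /eqP ->.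
under eq_bigr => i _ do rewrite rmorphN fmorph_rat.
rewrite sumr_const => /eqP; rewrite mulrn_eq0 eqn0Ngt I_gt0 /= => /eqP //.
Qed.

(** * Square-free parts *)

Lemma absz1_unit (m : int) : `|m|%N = 1%N -> m \is a GRing.unit.
Proof. by case: m => [[|[]]|[]]. Qed.

(** Take the largest [k] whose square divides [n]: a square [m ^+ 2] dividing the cofactor [t] would
    make [m * k] another candidate. The sign of [n] stays in [t]. *)
Lemma int_square_part (n : int) : n != 0 ->
  exists (t : int) (k : nat), squarefree_int t /\ n = t * k%:Z ^+ 2.
Proof.
move=> n_neq0; have n_gt0 : (0 < `|n|)%N by rewrite absz_gt0.
have ex1 : exists k, (k ^ 2 %| `|n|)%N by exists 1%N; rewrite dvd1n.
have le_n k : (k ^ 2 %| `|n|)%N -> (k <= `|n|)%N.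
  by move/(dvdn_leq n_gt0); apply: leq_trans; case: k => // k; rewrite -mulnn leq_pmulr.
case: (ex_maxnP ex1 le_n) => k k2n k_max.
have k_gt0 : (0 < k)%N.
  by rewrite lt0n; apply/eqP => k0; move: k2n; rewrite k0 dvd0n eqn0Ngt n_gt0.
have /dvdzP[t Dt] : (k%:Z ^+ 2 %| n)%Z by rewrite dvdzE abszX.
exists t, k; split=> // m /dvdzP[t' Dt'].
have m_le1 : (`|m| * k <= 1 * k)%N.
  have : ((m * k%:Z) ^+ 2 %| n)%Z by rewrite Dt Dt' exprMn -mulrA dvdz_mull.
  by rewrite dvdzE abszX abszM mul1n => /k_max.
have m_gt0 : (0 < `|m|)%N.
  by rewrite absz_gt0; apply: contraNneq n_neq0 => m0; rewrite Dt Dt' m0 expr0n mulr0 mul0r.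
rewrite leq_pmul2r // in m_le1.
by apply/absz1_unit/eqP; rewrite eqn_leq m_le1.
Qed.

(** A fraction n/d equals nd divided by a square, which reduces the claim to the integer nd. *)
Lemma rat_square_part (D : rat) : D != 0 ->
  exists (t : int) (m : rat), squarefree_int t /\ D = t%:~R * m ^+ 2.
Proof.
move=> D_neq0; have nd_neq0 : numq D * denq D != 0.
  by rewrite mulf_neq0 ?numq_eq0 ?denq_neq0.
have [t [k [t_sqf Dt]]] := int_square_part nd_neq0.
exists t, (k%:R / (denq D)%:~R); split=> //.
have d_neq0 : (denq D)%:~R != 0 :> rat by rewrite intr_eq0 denq_neq0.
rewrite expr_div_n mulrA; apply: canRL (mulfK _) _; first by rewrite expf_neq0.
rewrite -{1}(divq_num_den D) expr2 mulrA divfK // -intrM Dt.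
by rewrite intrM rmorphXn.
Qed.

Lemma squarefree_int1 : squarefree_int 1.
Proof.
move=> m; rewrite dvdzE abszX /= dvdn1 => m2.
by apply/absz1_unit/eqP; rewrite -(eqn_exp2r _ 1 (isT : 0 < 2)%N).
Qed.

(** * Pairs of polynomials conjugate over a quadratic field *)

(** The sum [Q + Q'] is invariant, while [Q - Q'] changes sign together with its leading coefficient
    [delta]. Hence [delta ^+ 2] and the quotient of [Q - Q'] by [delta] are rational. *)
Lemma conj_pair_quadratic (Q Q' : {poly algC}) :
    (forall nu : {rmorphism algC -> algC},
       map_poly nu Q = Q /\ map_poly nu Q' = Q'
       \/ map_poly nu Q = Q' /\ map_poly nu Q' = Q) ->
  exists (t : int) (s : algC) (U W : {poly rat}),
    [/\ squarefree_int t, s ^+ 2 = t%:~R,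
        Q = map_poly ratr U + s *: map_poly ratr W
      & Q' = map_poly ratr U - s *: map_poly ratr W].
Proof.
have coef_aut (nu : {rmorphism algC -> algC}) A B i :
  map_poly nu A = B -> nu A`_i = B`_i by move=> <-; rewrite coef_map.
have ratP (A : {poly algC}) :
    (forall nu : {rmorphism algC -> algC}, map_poly nu A = A) ->
  exists U : {poly rat}, A = map_poly ratr U.
  move=> nuA; exists (\poly_(i < size A) getCrat A`_i).
  apply/polyP=> i; rewrite coef_map coef_poly /=; case: ltnP => [_|ltAi].
    by rewrite getCratK //; apply: Crat_fixed => nu; apply: coef_aut.
  by rewrite nth_default // rmorph0.
move=> nuQ; have [QQ'|] := eqVneq Q Q'.
  (* When the two polynomials coincide they are rational, and [t = s = 1] with [W = 0] will do. *)
  have [U DU] : exists U, Q = map_poly ratr U.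
    by apply: ratP => nu; case: (nuQ nu) => -[// nuE _]; rewrite nuE.
  exists 1, 1, U, 0; rewrite rmorph0 scaler0 addr0 subr0 -QQ' -DU expr1n.
  by split=> //; apply: squarefree_int1.
rewrite -subr_eq0 -lead_coef_eq0; set delta := lead_coef _ => delta_neq0.
have nu_delta (nu : {rmorphism algC -> algC}) :
    map_poly nu Q = Q /\ map_poly nu Q' = Q' /\ nu delta = delta
    \/ map_poly nu Q = Q' /\ map_poly nu Q' = Q /\ nu delta = - delta.
  rewrite /delta -lead_coef_map rmorphB /= -lead_coefN opprB.
  by case: (nuQ nu) => -[-> ->]; [left | right].
have [U DU] : exists U, 2^-1 *: (Q + Q') = map_poly ratr U.
  apply: ratP => nu; rewrite map_polyZ rmorphD /= fmorphV rmorph_nat.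
  by case: (nuQ nu) => -[-> ->] //; rewrite addrC.
have [W DW] : exists W, (2 * delta)^-1 *: (Q - Q') = map_poly ratr W.
  apply: ratP => nu; rewrite map_polyZ rmorphB /= fmorphV rmorphM rmorph_nat.
  case: (nu_delta nu) => -[-> [-> ->]] //.
  by rewrite mulrN invrN scaleNr -scalerN opprB.
have [D DD] : exists D, delta ^+ 2 = ratr D.
  apply/CratP/Crat_fixed => nu; rewrite rmorphXn /=.
  by case: (nu_delta nu) => -[_ [_ ->]]; rewrite ?sqrrN.
have D_neq0 : D != 0.
  by apply: contraNneq delta_neq0 => D0; rewrite -sqrf_eq0 DD D0 rmorph0.
have [t [m [t_sqf Dt]]] := rat_square_part D_neq0.
have m_neq0 : m != 0 by apply: contraNneq D_neq0 => m0; rewrite Dt m0 expr0n mulr0.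
have Cm_neq0 : ratr m != 0 :> algC by rewrite fmorph_eq0.
have two_neq0 : 2 != 0 :> algC by rewrite pnatr_eq0.
(* Dividing [delta] by [m] leaves a square root of the square-free [t]; the second polynomial
   absorbs the factor [m]. *)
exists t, (delta / ratr m), U, (m *: W); split=> //.
- rewrite expr_div_n DD Dt rmorphM rmorph_int rmorphXn mulfK //.
  by rewrite expf_neq0.
- rewrite map_polyZ /= scalerA divfK // -DU -DW scalerA invfM mulrCA divff // mulr1.
  by rewrite -scalerDr addrACA subrr addr0 -mulr2n -scaler_nat scalerA mulVf ?scale1r.
- rewrite map_polyZ /= scalerA divfK // -DU -DW scalerA invfM mulrCA divff // mulr1.
  rewrite -scalerBr opprB addrC addrA subrK.
  by rewrite -mulr2n -scaler_nat scalerA mulVf ?scale1r.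
Qed.

(** * From a factorization of [p] to each of the four forms *)

Lemma poly_size5E (R : nzRingType) (q : {poly R}) : (size q <= 5)%N ->
  q = q`_4 *: 'X^4 + q`_3 *: 'X^3 + q`_2 *: 'X^2 + q`_1 *: 'X + (q`_0)%:P.
Proof.
move=> q5; apply/polyP=> i; rewrite !coefD !coefZ !coefXn coefX coefC.
case: i => [|[|[|[|[|i]]]]] /=; rewrite ?(mulr0, mulr1, addr0, add0r) //.
by rewrite nth_default // (leq_trans q5).
Qed.

(** The difference of squares is the norm, from the field of sqrt t, of a quartic without cubic
    term, that is, with roots of sum zero. *)
Lemma p1_norm (a b c d e f t : rat) :
  p1 a b c d e f t =
  ('X^4 + a *: 'X^2 + c *: 'X + e%:P) ^+ 2
  - t *: (b *: 'X^2 + d *: 'X + f%:P) ^+ 2.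
Proof. by rewrite /p1 -!mul_polyC; ring. Qed.

(* The norm of Y^2 + (b + c sqrt t) Y + (d + e sqrt t), Y = X^2 - a (sqrt t) X. *)
Lemma p2_norm (a b c d e t : rat) :
  p2 a b c d e t =
  ('X^4 + (a ^+ 2 * t + b) *: 'X^2 - (a * c * t) *: 'X + d%:P) ^+ 2
  - t *: (- (2 * a) *: 'X^3 + c *: 'X^2 - (a * b) *: 'X + e%:P) ^+ 2.
Proof. by rewrite /p2 -!mul_polyC; ring. Qed.

Definition has_form (p : {poly rat}) : Prop :=
  exists (a b c d e f : rat) (t : int),
    squarefree_int t /\
    [\/ p = p1 a b c d e f t%:~R, p = p2 a b c d e t%:~R,
        p = p3 a b c d | p = p4 a b c d].

(* The norm of q(X - sqrt a), where q = X^4 + b X^2 + c X + d. *)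
Lemma p3_norm (a b c d : rat) :
  p3 a b c d =
  ('X^4 + (6 * a + b) *: 'X^2 + c *: 'X + (a ^+ 2 + a * b + d)%:P) ^+ 2
  - a *: (4 *: 'X^3 + (4 * a + 2 * b) *: 'X + c%:P) ^+ 2.
Proof. by rewrite /p3 -!mul_polyC; ring. Qed.

Lemma map_p3 (a b c d : rat) (w : algC) (q : {poly algC}) :
    w ^+ 2 = ratr a -> q = 'X^4 + ratr b *: 'X^2 + ratr c *: 'X + (ratr d)%:P ->
  map_poly ratr (p3 a b c d) = (q \Po ('X - w%:P)) * (q \Po ('X + w%:P)).
Proof.
pose R : {rmorphism rat -> algC} := ratr.
have mapD := rmorphD (map_poly R).
have RE := (rmorph_nat R, rmorphD R, rmorphM R, rmorphXn R).
move=> Dw ->; rewrite p3_norm rmorphB rmorphXn /= map_polyZ rmorphXn /=.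
rewrite !mapD /= !map_polyZ !map_polyC !map_polyXn map_polyX /=.
rewrite !(comp_polyD, comp_polyZ, comp_polyX, comp_Xn_poly, comp_polyC).
rewrite !RE /= -Dw -!mul_polyC.
by ring.
Qed.

Lemma has_form_p3 (p : {poly rat}) (a b c d : rat) (w : algC) (q : {poly algC}) :
    w ^+ 2 = ratr a -> q = 'X^4 + ratr b *: 'X^2 + ratr c *: 'X + (ratr d)%:P ->
    map_poly ratr p = (q \Po ('X - w%:P)) * (q \Po ('X + w%:P)) ->
  has_form p.
Proof.
move=> Dw Dq; rewrite -(map_p3 Dw Dq) => /map_poly_inj Dp.
exists a, b, c, d, 0, 0, 1; split; first exact: squarefree_int1.
by constructor 3.
Qed.

(** The leading terms of the monic quartics cancel in [Q - Q'], so [U] is a monic quartic and [W] is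
    at most cubic; the coefficient formulas then determine the parameters of the form. *)
Lemma conj_pair_norm (p : {poly rat}) (Q Q' : {poly algC}) :
    map_poly ratr p = Q * Q' -> (size Q <= 5)%N -> (size Q' <= 5)%N ->
    Q`_4 = 1 -> Q'`_4 = 1 ->
    (forall nu : {rmorphism algC -> algC},
       map_poly nu Q = Q /\ map_poly nu Q' = Q'
       \/ map_poly nu Q = Q' /\ map_poly nu Q' = Q) ->
  exists (t : int) (s : algC) (U W : {poly rat}),
    [/\ squarefree_int t,
        s != 0 /\ s ^+ 2 = ratr t%:~R,
        forall i, ratr U`_i = (Q`_i + Q'`_i) / 2
          /\ s * ratr W`_i = (Q`_i - Q'`_i) / 2,
        p = U ^+ 2 - t%:~R *: W ^+ 2
      & U = 'X^4 + U`_3 *: 'X^3 + U`_2 *: 'X^2 + U`_1 *: 'X + (U`_0)%:P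
        /\ W = W`_3 *: 'X^3 + W`_2 *: 'X^2 + W`_1 *: 'X + (W`_0)%:P].
Proof.
move=> Dp Q5 Q'5 Q4 Q'4 /conj_pair_quadratic[t [s [U [W [t_sqf Ds DQ DQ']]]]].
(* A square-free [t] is nonzero: the square of 2 divides 0, and 2 is not a unit. *)
have s_neq0 : s != 0.
  apply/eqP => s0; move/eqP: Ds; rewrite s0 expr0n eq_sym intr_eq0 => /eqP t0.
  by have /t_sqf : ((2 : int) ^+ 2 %| t)%Z by rewrite t0 dvdz0.
have two_neq0 : 2 != 0 :> algC by rewrite pnatr_eq0.
have UW i : ratr U`_i = (Q`_i + Q'`_i) / 2 /\ s * ratr W`_i = (Q`_i - Q'`_i) / 2.
  rewrite DQ DQ' coefD coefB coefZ !coef_map /=.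
  by split; apply: canRL (mulfK _) _ => //; ring.
have Uval i c : Q`_i + Q'`_i = 2 * ratr c -> U`_i = c.
  move=> Dc; apply: (fmorph_inj (ratr : {rmorphism rat -> algC})).
  by rewrite /= (UW i).1 Dc mulrC mulKf.
have W0 i : Q`_i = Q'`_i -> W`_i = 0.
  move=> Qi; apply/eqP; rewrite -(fmorph_eq0 (ratr : {rmorphism rat -> algC})).
  by rewrite -(mulrI_eq0 _ (mulfI s_neq0)) /= (UW i).2 Qi subrr mul0r.
have U4 : U`_4 = 1 by apply: Uval; rewrite Q4 Q'4 rmorph1; ring.
have W4 : W`_4 = 0 by apply: W0; rewrite Q4 Q'4.
have sizeW : (size W <= 5)%N.
  by apply/leq_sizeP => i i5; apply: W0; rewrite !nth_default // (leq_trans _ i5).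
have sizeU : (size U <= 5)%N.
  apply/leq_sizeP => i i5; apply: Uval.
  by rewrite !nth_default ?(leq_trans _ i5) // rmorph0; ring.
exists t, s, U, W; split=> //.
- by rewrite Ds rmorph_int.
- apply: (map_poly_inj (ratr : {rmorphism rat -> algC})).
  rewrite /= Dp DQ DQ' rmorphB !rmorphXn /= map_polyZ /= rmorphXn /= rmorph_int -Ds.
  by rewrite -!mul_polyC; ring.
- by rewrite {1}(poly_size5E sizeU) {1}(poly_size5E sizeW) U4 W4 scale1r scale0r add0r.
Qed.

Lemma has_form_p1 (p : {poly rat}) (Q Q' : {poly algC}) :
    map_poly ratr p = Q * Q' -> (size Q <= 5)%N -> (size Q' <= 5)%N ->
    Q`_4 = 1 -> Q'`_4 = 1 -> Q`_3 = 0 -> Q'`_3 = 0 ->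
    (forall nu : {rmorphism algC -> algC},
       map_poly nu Q = Q /\ map_poly nu Q' = Q'
       \/ map_poly nu Q = Q' /\ map_poly nu Q' = Q) ->
  has_form p.
Proof.
move=> Dp Q5 Q'5 Q4 Q'4 Q3 Q'3 nuQ.
have [t [s [U [W [t_sqf [s_neq0 Ds] UW -> [-> ->]]]]]] :=
  conj_pair_norm Dp Q5 Q'5 Q4 Q'4 nuQ.
have [U3 W3] := UW 3%N; rewrite Q3 Q'3 subr0 addr0 mul0r in U3 W3.
have {}U3 : U`_3 = 0 by apply/eqP; rewrite -(fmorph_eq0 (ratr : {rmorphism rat -> algC})) /= U3.
have {}W3 : W`_3 = 0.
  move/eqP: W3; rewrite mulf_eq0 (negPf s_neq0) /=.
  by rewrite (fmorph_eq0 (ratr : {rmorphism rat -> algC})) => /eqP.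
exists U`_2, W`_2, U`_1, W`_1, U`_0, W`_0, t; split=> //.
by constructor 1; rewrite p1_norm U3 W3 !scale0r addr0 add0r.
Qed.

(** The two factors of [Q] share their linear coefficient, so [Q] is a quadratic in Y = X^2 - xX
    with coefficients [m + n] and [m * n]. Likewise [Q'] is a quadratic in X^2 + xX, and the
    conjugation turns [x] into [- x]. *)
Lemma has_form_p2 (p : {poly rat}) (Q Q' : {poly algC}) (x m m' n n' : algC) :
    map_poly ratr p = Q * Q' ->
    Q = ('X^2 - x *: 'X + m%:P) * ('X^2 - x *: 'X + n%:P) ->
    Q' = ('X^2 + x *: 'X + m'%:P) * ('X^2 + x *: 'X + n'%:P) ->
    (forall nu : {rmorphism algC -> algC},
       map_poly nu Q = Q /\ map_poly nu Q' = Q'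
       \/ map_poly nu Q = Q' /\ map_poly nu Q' = Q) ->
  has_form p.
Proof.
move=> Dp DQ DQ' nuQ.
have {}DQ : Q = Poly [:: m * n; - x * (m + n); x ^+ 2 + m + n; - 2 * x; 1].
  by rewrite DQ /= !cons_poly_def -!mul_polyC; ring.
have {}DQ' : Q' = Poly [:: m' * n'; x * (m' + n'); x ^+ 2 + m' + n'; 2 * x; 1].
  by rewrite DQ' /= !cons_poly_def -!mul_polyC; ring.
have [Q5 Q'5] : (size Q <= 5)%N /\ (size Q' <= 5)%N.
  by rewrite DQ DQ' !(leq_trans (size_Poly _)).
have [Q4 Q'4] : Q`_4 = 1 /\ Q'`_4 = 1 by rewrite DQ DQ' !coef_Poly.
have [t [s [U [W [t_sqf [s_neq0 Ds] UW -> [-> ->]]]]]] :=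
  conj_pair_norm Dp Q5 Q'5 Q4 Q'4 nuQ.
have two_neq0 : 2 != 0 :> algC by rewrite pnatr_eq0.
have := UW 0%N; have := UW 1%N; have := UW 2%N; have := UW 3%N.
rewrite DQ DQ' !coef_Poly /=.
case=> U3 W3 [U2 W2] [U1 W1] [U0 W0].
have ratI := fmorph_inj (ratr : {rmorphism rat -> algC}).
pose R : {rmorphism rat -> algC} := ratr.
have RE := (fmorphV R, rmorph_nat R, rmorphN R, rmorphD R, rmorphM R, rmorphXn R).
(* The cubic coefficients of [Q] and [Q'] are -2x and 2x, so [s] times the cubic coefficient of [W]
   is -2x. *)
have [a Da] : exists a, a = - W`_3 / 2 by eexists.
have Dx : x = ratr a * s by rewrite Da !RE /= mulrAC mulNr [_ * s]mulrC W3; field.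
have {}U3 : U`_3 = 0 by apply: ratI; rewrite /= U3 rmorph0; field.
have {}W3 : W`_3 = - (2 * a) by rewrite Da; field.
(* The rational part of [m + n] is the quadratic coefficient of [U] minus [x ^+ 2]; it is the
   parameter [b] of [p2]. *)
have Dm : m + n = ratr (U`_2 - a ^+ 2 * t%:~R) + s * ratr W`_2.
  by rewrite W2 rmorphB !RE /= -Ds U2 Dx; field.
have Dm' : m' + n' = ratr (U`_2 - a ^+ 2 * t%:~R) - s * ratr W`_2.
  by rewrite W2 rmorphB !RE /= -Ds U2 Dx; field.
have {}U1 : U`_1 = - (a * W`_2 * t%:~R).
  by apply: ratI; rewrite /= U1 Dm Dm' Dx !RE /= -Ds; field.
have {}W1 : W`_1 = - (a * (U`_2 - a ^+ 2 * t%:~R)).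
  apply: ratI; apply: (mulfI s_neq0).
  by rewrite /= W1 Dm Dm' Dx !RE /=; field.
exists a, (U`_2 - a ^+ 2 * t%:~R), W`_2, U`_0, W`_0, 0, t; split=> //.
constructor 2; rewrite p2_norm U3 U1 W3 W1 scale0r addr0.
by rewrite -!mul_polyC; ring.
Qed.

Lemma coef_comp_oppX (R : comNzRingType) (q : {poly R}) i :
  (q \Po - 'X)`_i = (-1) ^+ i * q`_i.
Proof.
rewrite comp_polyE (eq_bigr (fun j : 'I__ => ((-1) ^+ j * q`_j) *: 'X^j)).
  rewrite -(poly_def _ (fun j => (-1) ^+ j * q`_j)) coef_poly.
  by case: ltnP => // le_i; rewrite nth_default ?mulr0.
by move=> j _; rewrite -scaleN1r exprZn scalerA mulrC.
Qed.

(** Negation permutes the roots and the eight signs cancel, so [p] is invariant under X -> -X and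
    its odd coefficients vanish. *)
Lemma has_form_p4 (p : {poly rat}) (rs : seq algC) :
    map_poly ratr p = \prod_(y <- rs) ('X - y%:P) -> size rs = 8%N -> uniq rs ->
    {in rs, forall y, - y \in rs} ->
  has_form p.
Proof.
move=> Dp rs8 rs_uniq rsN.
have rs_perm : perm_eq (map -%R rs) rs.
  apply: uniq_perm => //; first by rewrite map_inj_uniq //; apply: oppr_inj.
  move=> y; apply/mapP/idP => [[z /rsN ? ->] //|/rsN yN].
  by exists (- y); rewrite ?opprK.
have pN : p \Po - 'X = p.
  apply: (map_poly_inj (ratr : {rmorphism rat -> algC})).
  rewrite map_comp_poly /= rmorphN /= map_polyX Dp rmorph_prod.
  rewrite -[RHS](perm_big _ rs_perm) big_map /=.
  rewrite (eq_bigr (fun y => -1 * ('X - (- y)%:P))) => [|y _].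
    by rewrite big_split big_const_seq count_predT rs8 iter_mulr_1 /= -signr_odd mul1r.
  rewrite rmorphB /= comp_polyX comp_polyC rmorphN /=; ring.
have psize : size p = 9.
  by rewrite -(size_map_poly (ratr : {rmorphism rat -> algC})) /= Dp size_prod_XsubC rs8.
have p8 : p`_8 = 1.
  apply: (fmorph_inj (ratr : {rmorphism rat -> algC})).
  have /monicP := monic_prod_XsubC rs predT id.
  by rewrite -Dp lead_coefE coef_map size_map_poly psize rmorph1.
have p_odd i : odd i -> p`_i = 0.
  move=> i_odd; have := congr1 (fun q : {poly rat} => q`_i) pN.
  rewrite /= coef_comp_oppX -signr_odd i_odd mulN1r => /eqP.
  by rewrite -subr_eq0 -opprD oppr_eq0 -mulr2n mulrn_eq0 => /eqP.
exists p`_6, p`_4, p`_2, p`_0, 0, 0, 1; split; first exact: squarefree_int1.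
constructor 4; rewrite /p4; apply/polyP => i.
rewrite !coefD !coefZ !coefXn coefC.
case: i => [|[|[|[|[|[|[|[|[|i]]]]]]]]] /=; rewrite ?(mulr0, mulr1, addr0, add0r, p8) //.
1-4: exact: p_odd.
by rewrite nth_default // psize.
Qed.

(** * Subsets of the roots as Boolean masks, and the action of automorphisms on them *)

Lemma perm_mask_negb (T : eqType) (s : seq T) (m : bitseq) :
  size m = size s -> perm_eq (mask m s ++ mask (map negb m) s) s.
Proof.
elim: s m => [|x s IHs] [|[] m] //= [/IHs m_perm]; first by rewrite perm_cons.
by rewrite (perm_catCA _ [:: x]) perm_cons.
Qed.

(* A subset of the list [rs] is encoded by a boolean mask; [pull rs nu v] is the
   mask of the preimage under [nu] of the subset with mask [v]. *)
Definition indicator (rs : seq algC) (v : bitseq) : pred algC :=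
  fun y => nth false v (index y rs).

Definition pull (rs : seq algC) (nu : algC -> algC) (v : bitseq) : bitseq :=
  [seq indicator rs v (nu y) | y <- rs].

Definition map2b (f : bool -> bool -> bool) (v w : bitseq) : bitseq :=
  [seq f x.1 x.2 | x <- zip v w].

Definition zero_quad (rs : seq algC) (v : bitseq) : bool :=
  [&& size v == size rs, count id v == 4%N & \sum_(y <- mask v rs) y == 0].

Lemma map_indicator rs v : uniq rs -> size v = size rs ->
  map (indicator rs v) rs = v.
Proof.
move=> rs_uniq v_size; apply: (@eq_from_nth _ false); rewrite size_map // => i i_lt.
by rewrite (nth_map 0) // /indicator index_uniq.
Qed.

Lemma filter_indicator rs v : uniq rs -> size v = size rs ->
  filter (indicator rs v) rs = mask v rs.
Proof. by move=> rs_uniq v_size; rewrite filter_mask map_indicator. Qed.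

Lemma perm_pull rs (nu : algC -> algC) v : uniq rs -> perm_eq (map nu rs) rs ->
  size v = size rs -> perm_eq (map nu (mask (pull rs nu v) rs)) (mask v rs).
Proof.
move=> rs_uniq nu_perm v_size; rewrite -(filter_indicator rs_uniq v_size).
by rewrite -filter_mask -filter_map perm_filter.
Qed.

Lemma size_pull rs nu v : size (pull rs nu v) = size rs.
Proof. exact: size_map. Qed.

Lemma count_pull rs (nu : algC -> algC) v : uniq rs -> perm_eq (map nu rs) rs ->
  size v = size rs -> count id (pull rs nu v) = count id v.
Proof.
move=> rs_uniq nu_perm v_size.
have /perm_size := perm_pull rs_uniq nu_perm v_size.
by rewrite size_map !size_mask ?size_pull.
Qed.

(** Preimages commute with Boolean operations: [andb] encodes intersection and [addb] symmetric
    difference. Bipartitions built from zero-sum quadruples can thus be followed through an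
    automorphism. *)
Lemma pull_map2b rs (nu : algC -> algC) f v w : perm_eq (map nu rs) rs ->
    size v = size rs -> size w = size rs ->
  pull rs nu (map2b f v w) = map2b f (pull rs nu v) (pull rs nu w).
Proof.
move=> nu_perm v_size w_size; rewrite /map2b /pull zip_map -map_comp.
apply/eq_in_map => y y_rs /=; rewrite /indicator (nth_map (false, false)).
  by rewrite nth_zip // v_size.
by rewrite size_zip v_size w_size minnn index_mem -(perm_mem nu_perm) map_f.
Qed.

(** The automorphism maps the sum over the preimage to the sum over the quadruple, and it is
    injective. *)
Lemma zero_quad_pull rs (nu : {rmorphism algC -> algC}) v :
    uniq rs -> perm_eq (map nu rs) rs ->
  zero_quad rs v -> zero_quad rs (pull rs nu v).
Proof.
move=> rs_uniq nu_perm /and3P[/eqP v_size v_count /eqP v_sum].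
rewrite /zero_quad size_pull eqxx count_pull // v_count /=.
rewrite -(fmorph_eq0 nu) rmorph_sum -(big_map nu predT id) /=.
by rewrite (perm_big _ (perm_pull rs_uniq nu_perm v_size)) /= v_sum.
Qed.

Lemma pull_negb rs (nu : algC -> algC) v : perm_eq (map nu rs) rs ->
  size v = size rs -> pull rs nu (map negb v) = map negb (pull rs nu v).
Proof.
move=> nu_perm v_size; rewrite /pull -map_comp; apply/eq_in_map => y y_rs /=.
by rewrite /indicator (nth_map false) // v_size index_mem -(perm_mem nu_perm) map_f.
Qed.

(* If two zero-sum quadruples shared exactly three elements, the two remaining
   elements would be equal; sharing exactly one reduces to this by complementing. *)
Lemma zero_quad_even (rs : seq algC) (v w : bitseq) :
    uniq rs -> size rs = 8%N -> \sum_(y <- rs) y = 0 ->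
    zero_quad rs v -> zero_quad rs w -> ~~ odd (count id (map2b andb v w)).
Proof.
move=> rs_uniq rs8 rs_sum0 /and3P[/eqP v_size /eqP v4 /eqP v0] /and3P[/eqP w_size /eqP w4 /eqP w0].
have zero_pred u : size u = size rs -> count id u = 4 -> \sum_(y <- mask u rs) y = 0 ->
    count (indicator rs u) rs = 4 /\ \sum_(y <- rs | indicator rs u y) y = 0.
  move=> u_size u4 u0; rewrite -big_filter filter_indicator // u0; split=> //.
  by rewrite -u4 -{2}(map_indicator rs_uniq u_size) count_map.
have [P4 P0] := zero_pred v v_size v4 v0; have [Q4 Q0] := zero_pred w w_size w4 w0.
have -> : count id (map2b andb v w) = count (predI (indicator rs v) (indicator rs w)) rs.
  rewrite -{1}(map_indicator rs_uniq v_size) -{1}(map_indicator rs_uniq w_size).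
  by rewrite /map2b zip_map -map_comp count_map.
move: (indicator rs v) (indicator rs w) P4 P0 Q4 Q0 => P Q {v w v_size w_size v4 w4 v0 w0 zero_pred}.
have countD (C D : pred algC) :
    (count (predI D C) rs + count (predI (predC D) C) rs)%N = count C rs.
  by rewrite -!count_filter count_predC size_filter.
have not3 (A B : pred algC) : count A rs = 4 -> \sum_(y <- rs | A y) y = 0 ->
    count B rs = 4 -> \sum_(y <- rs | B y) y = 0 -> count (predI A B) rs <> 3.
  move=> A4 A0 B4 B0 AB3.
  have single (C D : pred algC) : count C rs = 4 -> count (predI D C) rs = 3 ->
      \sum_(y <- rs | C y) y = 0 ->
    exists2 x, C x && ~~ D x & \sum_(y <- rs | C y && D y) y = - x.
    move=> C4 DC3 C0; have := countD C D; rewrite C4 DC3 => /eqP.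
    rewrite (eqn_add2l 3 _ 1) -size_filter => /eqP.
    case Df : (filter _ rs) => [|x []] // _.
    have : x \in filter (predI (predC D) C) rs by rewrite Df mem_head.
    rewrite mem_filter => /andP[/andP[nDx Cx] _]; exists x; first exact/andP.
    move/eqP: C0; rewrite (bigID D) /= addr_eq0 => /eqP->; congr (- _).
    rewrite (eq_bigl (predI (predC D) C)) => [|y]; last by rewrite /= andbC.
    by rewrite -big_filter Df big_seq1.
  have [x /andP[Ax nBx] Dx] := single A B A4 (etrans (eq_count (fun y => andbC _ _) rs) AB3) A0.
  have [y /andP[By nAy] Dy] := single B A B4 AB3 B0.
  have xy : x = y.
    by apply: oppr_inj; rewrite -Dx -Dy; apply: eq_bigl => z; rewrite andbC.
  by rewrite -xy Ax in nAy.
move=> P4 P0 Q4 Q0; have P3 := not3 P Q P4 P0 Q4 Q0.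
(* The complement of [Q] is also a zero-sum quadruple, and it meets [P] in three elements if [Q]
   meets [P] in one. *)
have nQ4 : count (predC Q) rs = 4.
  by move/eqP: (count_predC Q rs); rewrite rs8 Q4 (eqn_add2l 4 _ 4) => /eqP.
have nQ0 : \sum_(y <- rs | predC Q y) y = 0.
  by move: rs_sum0; rewrite (bigID Q) /= Q0 add0r.
have nP3 := not3 _ _ nQ4 nQ0 P4 P0.
have := countD P Q; rewrite P4 (eq_count (fun y => andbC _ _ : predI Q P y = predI P Q y)).
move: P3 nP3; move: (count (predI P Q) rs) (count (predI (predC Q) P) rs).
by move=> [|[|[|[|[|n]]]]] [|[|[|[|m]]]].
Qed.

(** * Configurations of zero-sum quadruples among eight roots, no two of them opposite *)

Record octet (p : {poly rat}) (rs : seq algC) : Prop := Octet {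
  octet_size : size rs = 8%N;
  octet_uniq : uniq rs;
  octet_sum : \sum_(y <- rs) y = 0;
  octet_prod : map_poly ratr p = \prod_(y <- rs) ('X - y%:P);
  octet_perm : forall nu : {rmorphism algC -> algC}, perm_eq (map nu rs) rs;
  octet_opp : {in rs &, forall y z, y + z != 0}
}.

(** All the conditions are symmetric in the roots, so quadruples can be moved to standard
    positions. *)
Lemma octet_reorder p rs rs' : perm_eq rs rs' -> octet p rs -> octet p rs'.
Proof.
move=> rs_rs' [rs8 rs_uniq rs_sum rs_prod rs_perm rs_opp]; split.
- by rewrite -(perm_size rs_rs').
- by rewrite -(perm_uniq rs_rs').
- by rewrite -(perm_big _ rs_rs').
- by rewrite -(perm_big _ rs_rs').
- move=> nu; rewrite perm_sym; apply: perm_trans (perm_map nu rs_rs').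
  by rewrite perm_sym; apply: perm_trans rs_rs'.
- by move=> y z; rewrite -!(perm_mem rs_rs'); apply: rs_opp.
Qed.

Lemma octet_half p rs v : octet p rs -> size v = size rs ->
    let Q := \prod_(y <- mask v rs) ('X - y%:P) in
    let Q' := \prod_(y <- mask (map negb v) rs) ('X - y%:P) in
  map_poly ratr p = Q * Q'.
Proof.
move=> oct v_size /=; rewrite (octet_prod oct) -big_cat.
by rewrite (perm_big _ (perm_mask_negb v_size)).
Qed.

(** An automorphism maps the roots selected by a preimage onto those selected by the mask. An
    invariant bipartition therefore gives two factors that every automorphism fixes or exchanges. *)
Lemma octet_conj_half p rs v : octet p rs -> size v = size rs ->
    let Q := \prod_(y <- mask v rs) ('X - y%:P) in
    let Q' := \prod_(y <- mask (map negb v) rs) ('X - y%:P) in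
    (forall nu : {rmorphism algC -> algC}, pull rs nu v \in [:: v; map negb v]) ->
  forall nu : {rmorphism algC -> algC},
    map_poly nu Q = Q /\ map_poly nu Q' = Q'
    \/ map_poly nu Q = Q' /\ map_poly nu Q' = Q.
Proof.
move=> oct v_size Q Q' v_pull nu.
have rs_uniq := octet_uniq oct; have nu_perm := octet_perm oct nu.
have nuQ w : size w = size rs -> map_poly nu (\prod_(y <- mask (pull rs nu w) rs) ('X - y%:P))
    = \prod_(y <- mask w rs) ('X - y%:P).
  move=> w_size; rewrite map_prod_XsubC -(big_map nu predT (fun y => 'X - y%:P)) /=.
  exact: perm_big (perm_pull rs_uniq nu_perm w_size).
have := nuQ _ v_size; have nv_size : size (map negb v) = size rs by rewrite size_map.
have := nuQ _ nv_size; rewrite (pull_negb nu_perm) //.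
have := v_pull nu; rewrite !inE => /orP[]/eqP->; first by left.
by rewrite (mapK negbK); right.
Qed.

Lemma monic_quartic (s : seq algC) (Q := \prod_(y <- s) ('X - y%:P)) :
  size s = 4%N -> [/\ (size Q <= 5)%N, Q`_4 = 1 & Q`_3 = - \sum_(y <- s) y].
Proof.
move=> s4; have Qs : size Q = 5 by rewrite size_prod_XsubC s4.
rewrite Qs -coefPn_prod_XsubC ?s4 //=; split=> //.
have /monicP := monic_prod_XsubC s predT id.
by rewrite lead_coefE Qs.
Qed.

Lemma has_form_one_pair p rs v : octet p rs -> zero_quad rs v ->
    (forall w, zero_quad rs w -> w \in [:: v; map negb v]) ->
  has_form p.
Proof.
move=> oct v_zero only_v; have rs_uniq := octet_uniq oct.
have /and3P[/eqP v_size /eqP v4 /eqP v0] := v_zero.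
have half := octet_half oct v_size.
have sum0 : \sum_(y <- mask (map negb v) rs) y = 0.
  move: (octet_sum oct); rewrite -(perm_big _ (perm_mask_negb v_size)) big_cat /= v0.
  by rewrite add0r.
have nv4 : count id (map negb v) = 4.
  have := count_predC id v; rewrite v4 v_size (octet_size oct) count_map => /eqP.
  by rewrite (eqn_add2l 4 _ 4) => /eqP.
have nuQ := octet_conj_half oct v_size
  (fun nu => only_v _ (zero_quad_pull rs_uniq (octet_perm oct nu) v_zero)).
have [Q5 Q4 Q3] : _ := monic_quartic (etrans (size_mask v_size) v4).
have nv_size : size (map negb v) = size rs by rewrite size_map.
have [Q'5 Q'4 Q'3] := monic_quartic (etrans (size_mask nv_size) nv4).
apply: has_form_p1 half Q5 Q'5 Q4 Q'4 _ _ nuQ; first by rewrite Q3 v0 oppr0.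
by rewrite Q'3 sum0 oppr0.
Qed.

(** With positions 0 to 7 written as three binary digits, the masks [maskS], [maskT], [maskU] select
    those whose first, second or third digit is 0: three faces of a cube meeting at the vertex 0. *)
Definition maskS : bitseq := [:: true; true; true; true; false; false; false; false].
Definition maskT : bitseq := [:: true; true; false; false; true; true; false; false].
Definition maskU : bitseq := [:: true; false; true; false; true; false; true; false].

(* r0 r1 | r2 r3 | r4 r5 | r6 r7 have sums x, -x, -x, x, and the automorphisms
   preserve {r0, r1, r6, r7} up to complement. *)
Lemma has_form_two_pairs p r0 r1 r2 r3 r4 r5 r6 r7
    (rs := [:: r0; r1; r2; r3; r4; r5; r6; r7]) :
    octet p rs -> zero_quad rs maskS -> zero_quad rs maskT ->
    (forall w, zero_quad rs w ->
      w \in [:: maskS; map negb maskS; maskT; map negb maskT]) ->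
  has_form p.
Proof.
move=> oct zS zT only_ST; have rs_uniq := octet_uniq oct.
pose v := map2b (fun a b => ~~ (a (+) b)) maskS maskT.
have v_pull (nu : {rmorphism algC -> algC}) : pull rs nu v \in [:: v; map negb v].
  (* Were the images of the two masks equal or complementary, the image of [v] would be full or
     empty; the preserved count of four excludes this. *)
  have nu_perm := octet_perm oct nu; have := count_pull rs_uniq nu_perm (erefl : size v = size rs).
  rewrite pull_map2b //.
  have := only_ST _ (zero_quad_pull rs_uniq nu_perm zS).
  have := only_ST _ (zero_quad_pull rs_uniq nu_perm zT).
  by rewrite !inE => /or4P[]/eqP-> /or4P[]/eqP->.
have := octet_half oct (erefl : size v = size rs).
have := octet_conj_half oct (erefl : size v = size rs) v_pull.
rewrite /= !big_cons !big_nil !mulr1 => nuQ Dp.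
have := octet_sum oct; move: zS zT => /and3P[_ _ /eqP] + /and3P[_ _ /eqP].
rewrite /= !big_cons !big_nil !addr0 => eS eT eq0.
(* The three vanishing sums show that the pairs r0 r1 and r6 r7 have the same sum x, and that r2 r3
   and r4 r5 have sum -x. *)
have r7E : r7 = r0 + r1 - r6.
  transitivity (r7 + (r0 + (r1 + (r2 + r3))) + (r0 + (r1 + (r4 + r5)))
    - (r0 + (r1 + (r2 + (r3 + (r4 + (r5 + (r6 + r7)))))))); last by ring.
  by rewrite eS eT eq0 !addr0 subr0.
have r3E : r3 = - (r0 + r1) - r2.
  by transitivity (r0 + (r1 + (r2 + r3)) - (r0 + r1) - r2); [ring | rewrite eS sub0r].
have r5E : r5 = - (r0 + r1) - r4.
  by transitivity (r0 + (r1 + (r4 + r5)) - (r0 + r1) - r4); [ring | rewrite eT sub0r].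
apply: (has_form_p2 (x := r0 + r1) (m := r0 * r1) (n := r6 * r7)
  (m' := r2 * r3) (n' := r4 * r5) Dp _ _ nuQ).
  by rewrite r7E -!mul_polyC; ring.
by rewrite r3E r5E -!mul_polyC; ring.
Qed.

(** The four-element masks meeting S, T and U evenly are the fourteen affine planes of the cube over
    the field of two elements. Six are faces. The other eight have sum 2d or -2d, where d is
    [r0 + r1], [r0 + r2], [r0 + r4] or [r0 - r7], and d is nonzero because no two roots are opposite
    or equal. *)
Lemma cube_zero_quads p r0 r1 r2 r3 r4 r5 r6 r7
    (rs := [:: r0; r1; r2; r3; r4; r5; r6; r7]) :
    octet p rs -> zero_quad rs maskS -> zero_quad rs maskT -> zero_quad rs maskU ->
  forall w, zero_quad rs w ->
    w \in [:: maskS; map negb maskS; maskT; map negb maskT; maskU; map negb maskU].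
Proof.
move=> oct zS zT zU w zw.
have rs_uniq := octet_uniq oct; have sum0 := octet_sum oct.
have parity u zu := @zero_quad_even rs u w rs_uniq (octet_size oct) sum0 zu zw.
have := parity _ zU; have := parity _ zT; have {parity} := parity _ zS.
have opp := octet_opp oct.
have /and3P[_ _ /eqP eS] := zS; have /and3P[_ _ /eqP eT] := zT.
have /and3P[_ _ /eqP eU] := zU; have /and3P[/eqP w_size /eqP + /eqP ew] := zw.
have two_neq0 : 2 != 0 :> algC by rewrite pnatr_eq0.
have ne01 : r0 + r1 != 0 by apply: opp; rewrite !inE eqxx ?orbT.
have ne02 : r0 + r2 != 0 by apply: opp; rewrite !inE eqxx ?orbT.
have ne04 : r0 + r4 != 0 by apply: opp; rewrite !inE eqxx ?orbT.
have ne07 : r0 - r7 != 0.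
  by rewrite subr_eq0; apply/eqP => r07; move: rs_uniq; rewrite /rs r07 /= !inE eqxx !orbT.
rewrite /= !big_cons !big_nil !addr0 in sum0 eS eT eU.
have key (d e : algC) : 2 * d = e -> d != 0 -> e != 0.
  by move=> <- d_neq0; rewrite mulf_neq0.
have nST : r0 + (r1 + (r6 + r7)) != 0.
  apply: key ne01; transitivity (r0 + (r1 + (r6 + r7)) + (r0 + (r1 + (r2 + r3)))
    + (r0 + (r1 + (r4 + r5))) - (r0 + (r1 + (r2 + (r3 + (r4 + (r5 + (r6 + r7)))))))).
    by ring.
  by rewrite eS eT sum0 !addr0 subr0.
have nSU : r0 + (r2 + (r5 + r7)) != 0.
  apply: key ne02; transitivity (r0 + (r2 + (r5 + r7)) + (r0 + (r1 + (r2 + r3)))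
    + (r0 + (r2 + (r4 + r6))) - (r0 + (r1 + (r2 + (r3 + (r4 + (r5 + (r6 + r7)))))))).
    by ring.
  by rewrite eS eU sum0 !addr0 subr0.
have nTU : r0 + (r3 + (r4 + r7)) != 0.
  apply: key ne04; transitivity (r0 + (r3 + (r4 + r7)) + (r0 + (r1 + (r4 + r5)))
    + (r0 + (r2 + (r4 + r6))) - (r0 + (r1 + (r2 + (r3 + (r4 + (r5 + (r6 + r7)))))))).
    by ring.
  by rewrite eT eU sum0 !addr0 subr0.
have nSTU : r0 + (r3 + (r5 + r6)) != 0.
  apply: key ne07; transitivity (r0 + (r3 + (r5 + r6)) + (r0 + (r1 + (r2 + r3)))
    + (r0 + (r1 + (r4 + r5))) + (r0 + (r2 + (r4 + r6)))
    - 2 * (r0 + (r1 + (r2 + (r3 + (r4 + (r5 + (r6 + r7)))))))).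
    by ring.
  by rewrite eS eT eU sum0 !addr0 mulr0 subr0.
have compl (A B : algC) : A + B = r0 + (r1 + (r2 + (r3 + (r4 + (r5 + (r6 + r7)))))) ->
    A != 0 -> B != 0.
  by rewrite sum0 => /eqP; rewrite addr_eq0 => /eqP->; rewrite oppr_eq0.
have nST' : r2 + (r3 + (r4 + r5)) != 0 by apply: compl nST; ring.
have nSU' : r1 + (r3 + (r4 + r6)) != 0 by apply: compl nSU; ring.
have nTU' : r1 + (r2 + (r5 + r6)) != 0 by apply: compl nTU; ring.
have nSTU' : r1 + (r2 + (r4 + r7)) != 0 by apply: compl nSTU; ring.
move: ew; case: w w_size {zw} => [|b0 [|b1 [|b2 [|b3 [|b4 [|b5 [|b6 [|b7 []]]]]]]]] // _.
case: b0; case: b1; case: b2; case: b3; case: b4; case: b5; case: b6; case: b7 => //=;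
  rewrite !big_cons big_nil addr0 => /eqP; rewrite ?(negPf nST) ?(negPf nSU)
   ?(negPf nTU) ?(negPf nSTU) ?(negPf nST') ?(negPf nSU') ?(negPf nTU') ?(negPf nSTU') //.
Qed.

(* Three quadruples index the roots by the vertices of a cube; antipodal
   vertices differ by +-2w, and the four midpoints are the roots of q. *)
Lemma has_form_cube p r0 r1 r2 r3 r4 r5 r6 r7
    (rs := [:: r0; r1; r2; r3; r4; r5; r6; r7]) :
    octet p rs -> zero_quad rs maskS -> zero_quad rs maskT -> zero_quad rs maskU ->
  has_form p.
Proof.
move=> oct zS zT zU; have only_STU := cube_zero_quads oct zS zT zU.
have rs_uniq := octet_uniq oct.
(* This selects the vertices 0, 3, 5, 6 of an inscribed tetrahedron, whose antipodes form the
   complement. *)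
pose v := map2b addb (map2b addb maskS maskT) maskU.
have v_pull (nu : {rmorphism algC -> algC}) : pull rs nu v \in [:: v; map negb v].
  have nu_perm := octet_perm oct nu.
  (* Symmetric differences keep four elements, so the three images come from distinct bipartitions;
     complementing any of them only complements [v]. A finite check over the six masks concludes. *)
  have count_xor (a b : bitseq) := count_pull rs_uniq nu_perm (v := map2b addb a b).
  have := count_xor maskS maskT erefl; have := count_xor maskS maskU erefl.
  have := count_xor maskT maskU erefl.
  rewrite !pull_map2b //.
  have := only_STU _ (zero_quad_pull rs_uniq nu_perm zS).
  have := only_STU _ (zero_quad_pull rs_uniq nu_perm zT).
  have := only_STU _ (zero_quad_pull rs_uniq nu_perm zU).
  move: (pull _ _ _) (pull _ _ _) (pull _ _ _).
  pose F := [:: maskS; map negb maskS; maskT; map negb maskT; maskU; map negb maskU].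
  suff : all (fun x => all (fun y => all (fun z =>
      [&& count id (map2b addb y x) == 4, count id (map2b addb z x) == 4
        & count id (map2b addb z y) == 4] ==>
      (map2b addb (map2b addb z y) x \in [:: v; map negb v])) F) F) F.
    move=> /allP allF z y x xF yF zF yx zx zy.
    by have /allP/(_ y yF)/allP/(_ z zF) := allF x xF; rewrite yx zx zy.
  by [].
have := octet_half oct (erefl : size v = size rs).
have := octet_conj_half oct (erefl : size v = size rs) v_pull.
set Q := (\prod_(_ <- mask v rs) _); set Q' := (\prod_(_ <- mask (map negb v) rs) _).
move=> nuQ Dp.
have := octet_sum oct; move: zS zT zU => /and3P[_ _ /eqP] + /and3P[_ _ /eqP] + /and3P[_ _ /eqP].
rewrite /= !big_cons !big_nil !addr0 => eS eT eU eq0.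
(* Each vertex of the tetrahedron exceeds its antipode by the same amount 2w. *)
pose w := (r0 - r7) / 2.
have two_neq0 : 2 != 0 :> algC by rewrite pnatr_eq0.
have r7E : r7 = r0 - 2 * w by rewrite /w; field.
have r1E : r1 = r6 - 2 * w.
  transitivity (r6 - (r0 - r7) + (r0 + (r1 + (r2 + r3))) + (r0 + (r1 + (r4 + r5)))
    - (r0 + (r1 + (r2 + (r3 + (r4 + (r5 + (r6 + r7)))))))); first by ring.
  by rewrite eS eT eq0 /w; field.
have r2E : r2 = r5 - 2 * w.
  transitivity (r5 - (r0 - r7) + (r0 + (r1 + (r2 + r3))) + (r0 + (r2 + (r4 + r6)))
    - (r0 + (r1 + (r2 + (r3 + (r4 + (r5 + (r6 + r7)))))))); first by ring.
  by rewrite eS eU eq0 /w; field.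
have r4E : r4 = r3 - 2 * w.
  transitivity (r3 - (r0 - r7) + (r0 + (r1 + (r4 + r5))) + (r0 + (r2 + (r4 + r6)))
    - (r0 + (r1 + (r2 + (r3 + (r4 + (r5 + (r6 + r7)))))))); first by ring.
  by rewrite eT eU eq0 /w; field.
have sumQ : \sum_(y <- mask v rs) y = 4 * w.
  rewrite /= !big_cons big_nil addr0.
  transitivity (4 * w + (r0 + (r1 + (r2 + (r3 + (r4 + (r5 + (r6 + r7))))))) / 2).
    by rewrite r1E r2E r4E r7E; field.
  by rewrite eq0 mul0r addr0.
have sumQ' : \sum_(y <- mask (map negb v) rs) y = - (4 * w).
  rewrite /= !big_cons big_nil addr0.
  transitivity ((r0 + (r1 + (r2 + (r3 + (r4 + (r5 + (r6 + r7)))))))  / 2 - 4 * w).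
    by rewrite r1E r2E r4E r7E; field.
  by rewrite eq0 mul0r sub0r.
pose s := [:: r0 - w; r3 - w; r5 - w; r6 - w].
pose q := \prod_(y <- s) ('X - y%:P).
have DQ : Q = q \Po ('X - w%:P).
  rewrite /Q /q /= !big_cons !big_nil !comp_polyM comp_polyC.
  by rewrite !comp_polyB !comp_polyX !comp_polyC; ring.
have DQ' : Q' = q \Po ('X + w%:P).
  rewrite /Q' /q /= !big_cons !big_nil !comp_polyM comp_polyC.
  by rewrite !comp_polyB !comp_polyX !comp_polyC r1E r2E r4E r7E; ring.
have Dq : q = Q \Po ('X + w%:P).
  by rewrite DQ -comp_polyA comp_polyB comp_polyX comp_polyC addrK comp_polyXr.
have Dq' : q = Q' \Po ('X - w%:P).
  by rewrite DQ' -comp_polyA comp_polyD comp_polyX comp_polyC subrK comp_polyXr.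
have [_ _ Q3] : _ := monic_quartic (erefl : size (mask v rs) = 4).
have [_ _ Q'3] : _ := monic_quartic (erefl : size (mask (map negb v) rs) = 4).
have four_neq0 : 4 != 0 :> algC by rewrite pnatr_eq0.
(* The cubic coefficients of [Q] and [Q'] are -4w and 4w, so exchanging the two polynomials negates
   [w]. *)
have nu_w (nu : {rmorphism algC -> algC}) :
    map_poly nu Q = Q /\ nu w = w \/ map_poly nu Q = Q' /\ nu w = - w.
  have Q3w : nu Q`_3 = - 4 * nu w by rewrite Q3 sumQ rmorphN rmorphM rmorph_nat mulNr.
  case: (nuQ nu) => -[nuQQ _]; [left | right]; split=> //.
    apply: (mulfI four_neq0); apply: oppr_inj.
    by rewrite -mulNr -Q3w -coef_map nuQQ Q3 sumQ.
  apply: (mulfI four_neq0); apply: oppr_inj.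
  by rewrite -mulNr -Q3w -coef_map nuQQ Q'3 sumQ' mulrN.
(* Shifting [Q] by [w] and [Q'] by [- w] both give [q], so [q] is invariant even when the two are
   exchanged. *)
have q_rat i : exists c, q`_i = ratr c.
  apply/CratP/Crat_fixed => nu; rewrite -coef_map; congr _`_i.
  rewrite {1}Dq map_comp_poly rmorphD /= map_polyX map_polyC.
  case: (nu_w nu) => -[-> /= ->]; first by rewrite -Dq.
  by rewrite polyCN -Dq'.
have [a Da] : exists a, w ^+ 2 = ratr a.
  apply/CratP/Crat_fixed => nu; rewrite rmorphXn /=.
  by case: (nu_w nu) => -[_ ->]; rewrite ?sqrrN.
have [[b Db] [c Dc] [d Dd]] := And3 (q_rat 2%N) (q_rat 1%N) (q_rat 0%N).
have := monic_quartic (erefl : size s = 4); rewrite -/q => -[q5 q4 q3].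
apply: (has_form_p3 (b := b) (c := c) (d := d) (q := q) Da); last by rewrite -DQ -DQ'.
rewrite {1}(poly_size5E q5) q4 -Db -Dc -Dd q3 (_ : \sum_(y <- s) y = 0).
  by rewrite oppr0 scale0r scale1r addr0.
transitivity (\sum_(y <- mask v rs) y - 4 * w); last by rewrite sumQ subrr.
by rewrite /= !big_cons !big_nil; ring.
Qed.

(** By parity, a further quadruple [w] meets the pairs r0 r1, r2 r3, r4 r5, r6 r7 all evenly or all
    oddly. If evenly, it is a union of two pairs: a known mask, or one of sum 2(r0 + r1) up to sign,
    which is nonzero. So it takes one root from each pair; swaps inside the pairs preserve [maskS]
    and [maskT] and bring it to [maskU]. *)
Lemma has_form_two_quads p r0 r1 r2 r3 r4 r5 r6 r7
    (rs := [:: r0; r1; r2; r3; r4; r5; r6; r7]) :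
  octet p rs -> zero_quad rs maskS -> zero_quad rs maskT -> has_form p.
Proof.
move=> oct zS zT; pose known := [:: maskS; map negb maskS; maskT; map negb maskT].
have rs_uniq := octet_uniq oct; have sum0 := octet_sum oct.
have [w /andP[zw w_new]|no_new] :=
    pickP (fun w : 8.-tuple bool => zero_quad rs w && (tval w \notin known)); last first.
  apply: has_form_two_pairs oct zS zT _ => w zw.
  have /and3P[w_size _ _] := zw.
  by have := no_new (Tuple w_size); rewrite /= zw => /negbT; rewrite negbK.
have /and3P[/eqP w_size /eqP + /eqP ew] := zw.
have := zero_quad_even rs_uniq (octet_size oct) sum0 zT zw.
have := zero_quad_even rs_uniq (octet_size oct) sum0 zS zw.
have /and3P[_ _ /eqP eS] := zS; have /and3P[_ _ /eqP eT] := zT.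
have ne01 : r0 + r1 != 0 by apply: (octet_opp oct); rewrite !inE eqxx ?orbT.
rewrite /= !big_cons !big_nil !addr0 in sum0 eS eT.
have nST : r0 + (r1 + (r6 + r7)) != 0.
  have -> : r0 + (r1 + (r6 + r7)) = 2 * (r0 + r1); last by rewrite mulf_neq0 // pnatr_eq0.
  transitivity (2 * (r0 + r1) + (r0 + (r1 + (r2 + (r3 + (r4 + (r5 + (r6 + r7)))))))
    - (r0 + (r1 + (r2 + r3))) - (r0 + (r1 + (r4 + r5)))); first by ring.
  by rewrite sum0 eS eT !subr0 addr0.
have nST' : r2 + (r3 + (r4 + r5)) != 0.
  have -> : r2 + (r3 + (r4 + r5)) = - (r0 + (r1 + (r6 + r7))); last by rewrite oppr_eq0.
  apply/eqP; rewrite -addr_eq0 -[X in _ == X]sum0; apply/eqP; ring.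
move: w_new ew; case: w {zw} w_size => w /= _.
case: w => [|b0 [|b1 [|b2 [|b3 [|b4 [|b5 [|b6 [|b7 []]]]]]]]] // _ w_new ew.
move=> evS evT w4.
have [/eqP ? /eqP ? /eqP ? /eqP ?] : [/\ b1 == ~~ b0, b3 == ~~ b2, b5 == ~~ b4 & b7 == ~~ b6].
  move: ew evS evT w4 w_new.
  case: b0; case: b1; case: b2; case: b3; case: b4; case: b5; case: b6; case: b7 => //=;
    by rewrite !big_cons big_nil addr0 => /eqP; rewrite ?(negPf nST) ?(negPf nST').
subst b1 b3 b5 b7; pose sel (b : bool) (x y : algC) := if b then x else y.
have perm_sel b x y : perm_eq [:: x; y] [:: sel b x y; sel (~~ b) x y].
  by case: b => //=; rewrite (perm_catC [:: x] [:: y]).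
have sum_sel b x y : sel b x y + sel (~~ b) x y = x + y by case: b; rewrite //= addrC.
apply: (@has_form_cube p (sel b0 r0 r1) (sel (~~ b0) r0 r1) (sel b2 r2 r3) (sel (~~ b2) r2 r3)
  (sel b4 r4 r5) (sel (~~ b4) r4 r5) (sel b6 r6 r7) (sel (~~ b6) r6 r7)).
- apply: octet_reorder oct; exact: (perm_cat (perm_sel b0 r0 r1) (perm_cat (perm_sel b2 r2 r3)
    (perm_cat (perm_sel b4 r4 r5) (perm_sel b6 r6 r7)))).
- by rewrite /zero_quad /= !big_cons big_nil addr0 addrA !sum_sel -addrA eS.
- by rewrite /zero_quad /= !big_cons big_nil addr0 addrA !sum_sel -addrA eT.
rewrite /zero_quad /= !big_cons big_nil addr0 -[X in _ == X]ew.
by rewrite /sel; case: b0 {w_new ew evS evT w4}; case: b2; case: b4; case: b6;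
  rewrite /= !big_cons big_nil addr0.
Qed.

(** A second quadruple meets the first in 0, 2 or 4 roots; the extremes are the complement and the
    first one itself. With two in each half, reordering inside the halves brings it to [maskT]. *)
Lemma has_form_octet p r0 r1 r2 r3 r4 r5 r6 r7
    (rs := [:: r0; r1; r2; r3; r4; r5; r6; r7]) :
  octet p rs -> zero_quad rs maskS -> has_form p.
Proof.
move=> oct zS; pose known := [:: maskS; map negb maskS].
have rs_uniq := octet_uniq oct; have sum0 := octet_sum oct.
have [w /andP[zw w_new]|no_new] :=
    pickP (fun w : 8.-tuple bool => zero_quad rs w && (tval w \notin known)); last first.
  apply: has_form_one_pair oct zS _ => w zw.
  have /and3P[w_size _ _] := zw.
  by have := no_new (Tuple w_size); rewrite /= zw => /negbT; rewrite negbK.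
have /and3P[/eqP w_size /eqP + /eqP ew] := zw.
have := zero_quad_even rs_uniq (octet_size oct) sum0 zS zw.
have /and3P[_ _ /eqP eS] := zS.
move: w_new ew; case: w {zw} w_size => w /= _.
case: w => [|b0 [|b1 [|b2 [|b3 [|b4 [|b5 [|b6 [|b7 []]]]]]]]] // _ w_new ew evS w4.
pose m1 := [:: b0; b1; b2; b3]; pose m2 := [:: b4; b5; b6; b7].
pose l1 := [:: r0; r1; r2; r3]; pose l2 := [:: r4; r5; r6; r7].
have /andP[/eqP m1_2 /eqP m2_2] : (count id m1 == 2) && (count id m2 == 2).
  rewrite /m1 /m2; move: evS w4 w_new {ew m1 m2}.
  by case: b0; case: b1; case: b2; case: b3; case: b4; case: b5; case: b6; case: b7.
have split_pairs (m : bitseq) (l : seq algC) : size m = 4 -> size l = 4 -> count id m = 2 ->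
    exists a b c d, perm_eq l [:: a; b; c; d] /\ mask m l = [:: a; b].
  move=> m4 l4 m2'; have ml : size m = size l by rewrite m4 l4.
  have := perm_mask_negb ml; have := size_mask ml; rewrite m2'.
  case: (mask m l) => [|a [|b []]] //= _ l_perm; move/perm_size: (l_perm); rewrite l4 /=.
  case: (mask _ l) l_perm => [|c [|d []]] // l_perm _.
  by exists a, b, c, d; rewrite perm_sym.
have [a0 [a1 [a2 [a3 [perm1 mask1]]]]] := split_pairs m1 l1 erefl erefl m1_2.
have [a4 [a5 [a6 [a7 [perm2 mask2]]]]] := split_pairs m2 l2 erefl erefl m2_2.
apply: (@has_form_two_quads p a0 a1 a2 a3 a4 a5 a6 a7).
- by apply: octet_reorder oct; apply: (perm_cat perm1 perm2).
- by rewrite /zero_quad /= -(perm_big _ perm1) -[X in _ == X]eS.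
have a0145 : [:: a0; a1; a4; a5] = mask (m1 ++ m2) (l1 ++ l2).
  by rewrite mask_cat // mask1 mask2.
by rewrite /zero_quad /= a0145; apply/eqP; apply: ew.
Qed.

(** * From a zero-sum relation to one of the forms *)

Lemma root_minCpoly_aut (x y : algC) (nu : {rmorphism algC -> algC}) :
  root (minCpoly x) (nu y) = root (minCpoly x) y.
Proof.
have [q [Dq _] _] := minCpolyP x.
by rewrite Dq -[in LHS](eq_map_poly (fmorph_rat nu)) (map_poly_comp nu) fmorph_root.
Qed.

Lemma has_form_of_relation (alpha : algC) (p : {poly rat}) (s : seq algC) :
    map_poly ratr p = minCpoly alpha -> size (minCpoly alpha) = 9%N ->
    uniq s -> size s = 4%N -> all (alg_conjugate alpha) s ->
    \sum_(y <- s) y = 0 -> has_form p.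
Proof.
move=> Dp size9 s_uniq s4 /allP s_conj s_sum.
have [rs Drs rs_uniq] := minCpoly_roots alpha.
have rs_root y : (y \in rs) = root (minCpoly alpha) y by rewrite Drs root_prod_XsubC.
have rs8 : size rs = 8%N by move: size9; rewrite Drs size_prod_XsubC => -[].
have rs_perm (nu : {rmorphism algC -> algC}) : perm_eq (map nu rs) rs.
  have nu_sub : {subset map nu rs <= rs}.
    by move=> _ /mapP[y y_rs ->]; rewrite rs_root root_minCpoly_aut -rs_root.
  have nu_uniq : uniq (map nu rs) by rewrite map_inj_uniq //; apply: fmorph_inj.
  have [|_ nu_rs] := uniq_min_size nu_uniq nu_sub; first by rewrite size_map.
  exact: uniq_perm.
have Dp_rs : map_poly ratr p = \prod_(y <- rs) ('X - y%:P) by rewrite Dp.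
(* If some root is the negative of a root, transitivity of the automorphisms carries this to every
   root, which gives [p4]. *)
have [/allrelP rs_opp | ] := boolP (allrel (fun y z => y + z != 0) rs rs); last first.
  rewrite -has_predC => /hasP[y y_rs] /=; rewrite -has_predC => /hasP[z z_rs] /=.
  rewrite negbK addr_eq0 => /eqP yz.
  apply: (has_form_p4 Dp_rs) => // u; rewrite rs_root => u_root.
  have y_root : root (minCpoly alpha) y by rewrite -rs_root.
  have [nu <-] : exists nu : {rmorphism algC -> algC}, nu y = u.
    by apply: conj_aut; rewrite (minCpoly_conj y_root).
  by rewrite yz rmorphN opprK rs_root root_minCpoly_aut -rs_root.
have s_rs : {subset s <= rs} by move=> y /s_conj; rewrite rs_root.
have rs_sum : \sum_(y <- rs) y = 0 by apply: conj_sum_eq0 Drs s_rs _ s_sum; rewrite s4.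
have oct : octet p rs by split.
(* Listing the given quadruple first makes it [maskS]. *)
have perm_s : perm_eq rs (s ++ [seq y <- rs | y \notin s]).
  rewrite -(perm_filterC (mem s)) perm_cat2r; apply: uniq_perm => //.
    exact: filter_uniq.
  by move=> y; rewrite mem_filter /=; case: (boolP (y \in s)) => // /s_rs ->.
have := perm_size perm_s; have {}oct := octet_reorder perm_s oct.
rewrite size_cat rs8 s4; move: oct; clear -s_sum s4.
case: s s4 s_sum => [|r0 [|r1 [|r2 [|r3 []]]]] //= _ s_sum.
case: (filter _ _) => [|r4 [|r5 [|r6 [|r7 []]]]] //= oct _.
apply: has_form_octet oct _.
by rewrite /zero_quad /= s_sum.
Qed.

(** * The converse: zero-sum quadruples from each form *)

Lemma monic_size5 (R : nzRingType) (Q : {poly R}) :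
  (size Q <= 5)%N -> Q`_4 = 1 -> size Q = 5%N /\ Q \is monic.
Proof.
move=> Q5 Q4; have Qsize : size Q = 5%N.
  apply/eqP; rewrite eqn_leq Q5 ltnNge; apply/negP => Q_le4.
  by move/eqP: Q4; rewrite nth_default // eq_sym oner_eq0.
by rewrite Qsize monicE lead_coefE Qsize Q4.
Qed.

Lemma monic_poly_normal (F : closedFieldType) (Q : {poly F}) :
  Q \is monic -> {s : seq F | Q = \prod_(y <- s) ('X - y%:P)}.
Proof.
by case: (closed_field_poly_normal Q) => s + /monicP Q1; rewrite Q1 scale1r; exists s.
Qed.

Definition zero_relation (alpha : algC) : Prop :=
  exists alpha1 alpha2 alpha3 alpha4 : algC,
    [/\ uniq [:: alpha1; alpha2; alpha3; alpha4],
        all (alg_conjugate alpha) [:: alpha1; alpha2; alpha3; alpha4]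
      & alpha1 + alpha2 + alpha3 + alpha4 = 0].

(** The roots of [Q] are four conjugates, distinct by separability, and the missing cubic term makes
    their sum zero. Each form then only has to provide such a quartic factor. *)
Lemma zero_relation_factor (alpha : algC) (Q Q' : {poly algC}) :
    minCpoly alpha = Q * Q' -> (size Q <= 5)%N -> Q`_4 = 1 -> Q`_3 = 0 ->
  zero_relation alpha.
Proof.
move=> Dp Q5 Q4 Q3; have [Qsize Q_monic] := monic_size5 Q5 Q4.
have Q'_monic : Q' \is monic.
  by rewrite -(monicMl _ Q_monic) -Dp minCpoly_monic.
have [s Ds] := monic_poly_normal Q_monic; have [s' Ds'] := monic_poly_normal Q'_monic.
have s4 : size s = 4 by move: Qsize; rewrite Ds size_prod_XsubC => -[].
have := minCpoly_separable alpha; have root_s y : y \in s -> alg_conjugate alpha y.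
  by move=> y_s; rewrite /alg_conjugate Dp rootM Ds root_prod_XsubC y_s.
rewrite Dp Ds Ds' -big_cat separable_prod_XsubC cat_uniq => /and3P[s_uniq _ _].
have s0 : \sum_(y <- s) y = 0.
  by have [_ _] := monic_quartic s4; rewrite -Ds Q3 => /esym/eqP; rewrite oppr_eq0 => /eqP.
move: s4 s_uniq root_s s0; case: s {Ds} => [|x1 [|x2 [|x3 [|x4 []]]]] // _ s_uniq root_s s0.
exists x1, x2, x3, x4; split=> //; first exact/allP.
by move: s0; rewrite !big_cons big_nil addr0 !addrA.
Qed.

Lemma quadratic_split (b c : algC) : exists m n, b = m + n /\ c = m * n.
Proof.
pose r := sqrtC (b ^+ 2 - 4 * c).
have r2 : r ^+ 2 = b ^+ 2 - 4 * c by rewrite sqrtCK.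
exists ((b + r) / 2), ((b - r) / 2); split; first by field.
have -> : (b + r) / 2 * ((b - r) / 2) = (b ^+ 2 - r ^+ 2) / 4 by field.
by rewrite r2; field.
Qed.

Lemma zero_relation_p1 alpha a b c d e f t :
  map_poly ratr (p1 a b c d e f t) = minCpoly alpha -> zero_relation alpha.
Proof.
rewrite p1_norm; set U := (_ + _ + _ + _); set W := (_ + _ + _) => Dp.
have DU : U = Poly [:: e; c; a; 0; 1].
  by rewrite /U /= !cons_poly_def -!mul_polyC; ring.
have DW : W = Poly [:: f; d; b].
  by rewrite /W /= !cons_poly_def -!mul_polyC; ring.
pose s : algC := sqrtC (ratr t); have s2 : s ^+ 2 = ratr t by rewrite sqrtCK.
apply: (@zero_relation_factor _ (map_poly ratr U + s *: map_poly ratr W)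
  (map_poly ratr U - s *: map_poly ratr W)).
- rewrite -Dp rmorphB !rmorphXn /= map_polyZ /= rmorphXn /= -s2.
  by rewrite -!mul_polyC; ring.
- rewrite (leq_trans (size_polyD _ _)) // geq_max (leq_trans (size_scale_leq _ _)) ?size_map_poly //.
    by rewrite andbT DU (leq_trans (size_Poly _)).
  by rewrite DW (leq_trans (size_Poly _)).
- by rewrite coefD coefZ !coef_map DU DW !coef_Poly /= rmorph1 rmorph0 mulr0 addr0.
by rewrite coefD coefZ !coef_map DU DW !coef_Poly /= rmorph0 mulr0 addr0.
Qed.

(** The two conjugate quartics have cubic coefficients -2x and 2x, so the factors are regrouped: one
    quadratic from each quartic, with linear coefficients -x and x that cancel. *)
Lemma zero_relation_p2 alpha a b c d e t :
  map_poly ratr (p2 a b c d e t) = minCpoly alpha -> zero_relation alpha.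
Proof.
pose R : {rmorphism rat -> algC} := ratr.
have mapE := (rmorphD (map_poly R), rmorphN (map_poly R)).
have RE := (rmorphN R, rmorph_nat R, rmorphD R, rmorphM R, rmorphXn R).
pose s : algC := sqrtC (ratr t); have s2 : s ^+ 2 = ratr t by rewrite sqrtCK.
pose x := ratr a * s.
have [m [n [mn_sum mn_prod]]] := quadratic_split (ratr b + ratr c * s) (ratr d + ratr e * s).
have [m' [n' [mn'_sum mn'_prod]]] := quadratic_split (ratr b - ratr c * s) (ratr d - ratr e * s).
have DU : map_poly R ('X^4 + (a ^+ 2 * t + b) *: 'X^2 - (a * c * t) *: 'X + d%:P)
  = 'X^4 + (x ^+ 2 + ratr b) *: 'X^2 - (x * (ratr c * s)) *: 'X + (ratr d)%:P.
  rewrite !mapE /= !map_polyZ map_polyC !map_polyXn map_polyX /= !RE /= -s2 -!mul_polyC.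
  by rewrite /x; ring.
have DW : s *: map_poly R (- (2 * a) *: 'X^3 + c *: 'X^2 - (a * b) *: 'X + e%:P)
  = - (2 * x) *: 'X^3 + (ratr c * s) *: 'X^2 - (x * ratr b) *: 'X + (ratr e * s)%:P.
  rewrite !mapE /= !map_polyZ map_polyC !map_polyXn map_polyX /= !RE /= -!mul_polyC.
  by rewrite /x; ring.
rewrite p2_norm rmorphB !rmorphXn /= map_polyZ /= rmorphXn /= -s2 -exprZn => Dp.
apply: (@zero_relation_factor _
  (('X^2 - x *: 'X + m%:P) * ('X^2 + x *: 'X + m'%:P))
  (('X^2 - x *: 'X + n%:P) * ('X^2 + x *: 'X + n'%:P))).
- pose P g u v : {poly algC} := ('X^2 - g *: 'X) ^+ 2 + u *: ('X^2 - g *: 'X) + v%:P.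
  have PE g m1 n1 : P g (m1 + n1) (m1 * n1) =
      ('X^2 - g *: 'X + m1%:P) * ('X^2 - g *: 'X + n1%:P).
    by rewrite /P -!mul_polyC; ring.
  transitivity (P x (m + n) (m * n) * P (- x) (m' + n') (m' * n')).
    rewrite -Dp DU DW -mn_sum -mn_prod -mn'_sum -mn'_prod /P -!mul_polyC; ring.
  by rewrite !PE !scaleNr !opprK; ring.
all: have -> : ('X^2 - x *: 'X + m%:P) * ('X^2 + x *: 'X + m'%:P) =
    Poly [:: m * m'; x * (m - m'); m + m' - x ^+ 2; 0; 1]
  by rewrite /= !cons_poly_def -!mul_polyC; ring.
- by rewrite (leq_trans (size_Poly _)).
- by rewrite coef_Poly.
by rewrite coef_Poly.
Qed.

Lemma zero_relation_p3 alpha a b c d :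
  map_poly ratr (p3 a b c d) = minCpoly alpha -> zero_relation alpha.
Proof.
pose w : algC := sqrtC (ratr a); have w2 : w ^+ 2 = ratr a by rewrite sqrtCK.
pose q : {poly algC} := 'X^4 + ratr b *: 'X^2 + ratr c *: 'X + (ratr d)%:P.
rewrite (map_p3 w2 (erefl q)) => Dp.
have Dq : q = Poly [:: ratr d; ratr c; ratr b; 0; 1].
  by rewrite /q /= !cons_poly_def -!mul_polyC; ring.
have q5 : (size q <= 5)%N by rewrite Dq (leq_trans (size_Poly _)).
have q4 : q`_4 = 1 by rewrite Dq coef_Poly.
have q3 : q`_3 = 0 by rewrite Dq coef_Poly.
have [q_size q_monic] := monic_size5 q5 q4.
have [y Dy] := monic_poly_normal q_monic; rewrite {q}Dy in Dp Dq q5 q4 q3 q_size q_monic *.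
have y4 : size y = 4 by move: q_size; rewrite size_prod_XsubC => -[].
have [_ _ y0] := monic_quartic y4; move: y0 Dp {Dq q5 q4 q_size q_monic}; rewrite q3.
case: y y4 {q3} => [|y1 [|y2 [|y3 [|y4 []]]]] // _ /esym/eqP.
rewrite oppr_eq0 !big_cons !big_nil !mulr1 addr0 => /eqP y0.
rewrite !comp_polyM !comp_polyB !comp_polyX !comp_polyC => Dp.
(* The roots are the [y] shifted by [w] and by [- w]. As the [y] sum to zero, shifting two up and
   two down keeps the sum zero. *)
pose x1 := y1 + w; pose x2 := y2 + w; pose x3 := y3 - w; pose x4 := y4 - w.
pose Q := ('X - x1%:P) * ('X - x2%:P) * ('X - x3%:P) * ('X - x4%:P).
have DQ : Q = \prod_(x <- [:: x1; x2; x3; x4]) ('X - x%:P).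
  by rewrite !big_cons big_nil mulr1 !mulrA.
have [] := monic_quartic (erefl : size [:: x1; x2; x3; x4] = 4).
rewrite -DQ => Q5 Q4 Q3; apply: (@zero_relation_factor _ Q
  (('X - (y1 - w)%:P) * ('X - (y2 - w)%:P) * ('X - (y3 + w)%:P) * ('X - (y4 + w)%:P))) => //.
  by rewrite -Dp /Q /x1 /x2 /x3 /x4; ring.
rewrite Q3 !big_cons big_nil addr0; apply/eqP; rewrite oppr_eq0 -y0; apply/eqP.
by rewrite /x1 /x2 /x3 /x4; ring.
Qed.

(** [p4] is a quartic in X^2; two of its four factors X^2 - y multiply to an even quartic, which has
    no cubic term. *)
Lemma zero_relation_p4 alpha a b c d :
  map_poly ratr (p4 a b c d) = minCpoly alpha -> zero_relation alpha.
Proof.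
pose R : {rmorphism rat -> algC} := ratr; have mapD := rmorphD (map_poly R).
pose q : {poly algC} := Poly [:: ratr d; ratr c; ratr b; ratr a; 1].
have -> : map_poly ratr (p4 a b c d) = q \Po 'X^2.
  rewrite /p4 !mapD /= !map_polyZ map_polyC !map_polyXn /= /q /= !cons_poly_def.
  rewrite !(comp_polyD, comp_polyM, comp_polyX, comp_polyC) -!mul_polyC; ring.
have q5 : (size q <= 5)%N by rewrite (leq_trans (size_Poly _)).
have q4 : q`_4 = 1 by rewrite coef_Poly.
have [q_size q_monic] := monic_size5 q5 q4.
have [y Dy] := monic_poly_normal q_monic; rewrite {q}Dy in q_size q5 q4 q_monic *.
have y4 : size y = 4 by move: q_size; rewrite size_prod_XsubC => -[].
move=> {q5 q4 q_monic q_size}; case: y y4 => [|y1 [|y2 [|y3 [|y4 []]]]] // _.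
rewrite !big_cons !big_nil !mulr1 !comp_polyM !comp_polyB !comp_polyX !comp_polyC => Dp.
have DQ : ('X^2 - y1%:P) * ('X^2 - y2%:P) = Poly [:: y1 * y2; 0; - (y1 + y2); 0; 1].
  by rewrite /= !cons_poly_def; ring.
apply: (@zero_relation_factor _ (('X^2 - y1%:P) * ('X^2 - y2%:P))
  (('X^2 - y3%:P) * ('X^2 - y4%:P))).
- by rewrite -Dp; ring.
- by rewrite DQ (leq_trans (size_Poly _)).
- by rewrite DQ coef_Poly.
by rewrite DQ coef_Poly.
Qed.

Theorem theorem3 (alpha : algC) (p : {poly rat})
    (p_min : map_poly ratr p = minCpoly alpha)
    (deg_alpha : (size (minCpoly alpha)).-1 = 8%N) :
  (exists alpha1 alpha2 alpha3 alpha4 : algC,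
     [/\ uniq [:: alpha1; alpha2; alpha3; alpha4],
         all (alg_conjugate alpha) [:: alpha1; alpha2; alpha3; alpha4]
       & alpha1 + alpha2 + alpha3 + alpha4 = 0])
  <->
  (irreducible_poly p /\
   exists (a b c d e f : rat) (t : int),
     squarefree_int t /\
     [\/ p = p1 a b c d e f t%:~R, p = p2 a b c d e t%:~R,
         p = p3 a b c d | p = p4 a b c d]).
Proof.
split=> [[x1 [x2 [x3 [x4 [x_uniq x_conj x_sum]]]]]|].
  split; first exact: minCpoly_irreducible p_min.
  have size9 : size (minCpoly alpha) = 9%N.
    by move: deg_alpha; case: (size _) => // n /= ->.
  apply: (has_form_of_relation p_min size9 x_uniq erefl x_conj).
  by rewrite !big_cons big_nil addr0 !addrA.
case=> _ [a [b [c [d [e [f [t [_ p_form]]]]]]]].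
by case: p_form p_min => ->;
  [apply: zero_relation_p1 | apply: zero_relation_p2
  | apply: zero_relation_p3 | apply: zero_relation_p4].
Qed.
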